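(* Let $\kappa\in(0,\infty)$ and $\nu\in(0,\infty)$ be real parameters. The double series $$\sum_{k=0}^{\infty}\frac{1}{2^{k+1}}\sum_{m=0}^{k}\binom{k}{m}\frac{(-1)^{m}}{(m+1)^{s}}\,\frac{\mathcal{B}_{\kappa}\left(1/(m+1)^{\nu}\right)}{\mathcal{B}_{\kappa}(0)}$$ converges absolutely and uniformly on compact sets to the entire function $\eta_{\kappa\nu}(s)$.
   Context: For real $x$ and a real parameter $\kappa\in(0,\infty)$, define $$\mathcal{B}_{\kappa}(x):=\frac12\left[\tanh\left(\frac{x+\frac12}{\kappa}\right)-\tanh\left(\frac{x-\frac12}{\kappa}\right)\right].$$ For real parameters $\kappa\in(0,\infty)$ and $\nu\in(0,\infty)$ and a complex variable $s$, the function $\eta_{\kappa\nu}(s)$ (called the holomorphic nonlinear embedding of the Dirichlet eta function) is defined as the series $$\eta_{\kappa\nu}(s):=\sum_{k=0}^{\infty}\frac{1}{2^{k+1}}\sum_{m=0}^{k}\binom{k}{m}\frac{(-1)^{m}}{(m+1)^{s}}\,\frac{\mathcal{B}_{\kappa}\left(1/(m+1)^{\nu}\right)}{\mathcal{B}_{\kappa}(0)}.$$ Here the Dirichlet eta function is $$\eta(s)=\sum_{k=0}^{\infty}\frac{1}{2^{k+1}}\sum_{m=0}^{k}\binom{k}{m}\frac{(-1)^{m}}{(m+1)^{s}}.$$ *)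

(* Defs.v *)
From HB Require Import structures.
From mathcomp Require Import all_boot all_order all_algebra.
From mathcomp Require Import all_classical all_reals all_analysis.
From mathcomp Require Export complex.

Set Implicit Arguments.
Unset Strict Implicit.
Unset Printing Implicit Defensive.

Import Order.TTheory GRing.Theory Num.Theory.
Import numFieldNormedType.Exports.
Export numFieldNormedType.Exports.

Local Open Scope classical_set_scope.
Local Open Scope ring_scope.
Local Open Scope complex_scope.

Section Embedding.
Context {R : realType}.

(* [R[i]^o] is [R[i]] with the topology of its modulus: topological instances
   are found on [K^o] for a numFieldType [K], but not on [complex R] itself. *)
Local Notation C := (R[i]^o).

Definition tanh (x : R) : R :=
  (expR x - expR (- x)) / (expR x + expR (- x)).

Definition B (kappa x : R) : R :=
  (tanh ((x + 2^-1) / kappa) - tanh ((x - 2^-1) / kappa)) / 2.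

Definition expC (z : R[i]) : R[i] :=
  (expR (complex.Re z) * cos (complex.Im z))
  +i* (expR (complex.Re z) * sin (complex.Im z)).

(* principal value [x ^ s] of a power, for a real base [x > 0] *)
Definition rpowC (x : R) (s : R[i]) : R[i] := expC (s * (ln x)%:C).

Definition eta_term (kappa nu : R) (k : nat) (s : C) : C :=
  (2 ^+ k.+1)^-1 *
  \sum_(0 <= m < k.+1)
     'C(k, m)%:R * ((-1) ^+ m / rpowC m.+1%:R s) *
     (B kappa (m.+1%:R `^ nu)^-1 / B kappa 0)%:C.

Definition eta (kappa nu : R) (s : C) : C :=
  limn (series (eta_term kappa nu ^~ s)).

Definition entire (f : C -> C) : Prop := forall s : C, derivable f s 1.

End Embedding.

(* Main.v *)
Require Import Defs.
From mathcomp Require Import all_boot all_order all_algebra.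
From mathcomp Require Import all_classical all_reals all_analysis.
From mathcomp Require Import ring lra zify.

Set Implicit Arguments.
Unset Strict Implicit.
Unset Printing Implicit Defensive.

Import Order.TTheory GRing.Theory Num.Theory.

Local Open Scope classical_set_scope.
Local Open Scope ring_scope.
Local Open Scope complex_scope.

(** The [k]-th term of the series is [2^-(k+1)] times the [k]-th iterated
    difference at [0] of the sequence [m |-> (m+1)^(-s) G(ln (m+1))], where
    [G u = B (e^(-nu u)) / B 0]. The triangle inequality bounds this difference
    by [2^k] times a binomial average of [(m+1)^(- Re s)], which is enough only
    for [Re s > 1]; what makes the series converge for every [s] is that
    differencing improves decay. In the variable [u = ln x] the
    sequence is sampled from [h u = e^(-s u) G u], all of whose derivatives are
    [O(e^(c u))] for one fixed [c]: this is the class [tempered], which is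
    stable under sums, products and integration, and which contains [G] because
    [tanh' = 1 - tanh^2] is bounded. Each [x]-derivative of [h (ln x)] gains a
    factor [1/x], so the derivative of order [c+2] is [O(x^-2)], and by the mean
    value theorem so is the difference of order [c+2].

    The remaining differences are a binomial average of these [O(j^-2)]
    values, and the identity
    [binom(n,j) / ((j+1)(j+2)) = binom(n+2,j+2) / ((n+1)(n+2))] turns the
    average into a bound [K / ((k+1)(k+2))] on the [k]-th term
    ([euler_term_le]). The constant is uniform over any family that is tempered
    uniformly in its parameter. Three families are used.

    - [e^(-s u) G u] with [s] in a box: this gives absolute convergence, and
      uniform convergence on compact sets ([eta_cvg]).
    - [- u e^(-s u) G u] with [s] fixed: the series of the [s]-derivatives of
      the terms converges.
    - [e^(-s u) (e^(-z u) - 1 + z u) / |z|^2 G u] with [s] fixed and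
      [0 < |z| <= 1]: the first-order Taylor remainders of the terms at [s] are
      at most [K |z|^2 / ((k+1)(k+2))], so the sum of the series is complex
      differentiable at [s] ([entire_eta]) without any appeal to Cauchy's
      theory.

    Complex sequences are handled through their real and imaginary parts, so
    that the mean value theorem applies. *)

(** * Functions with derivatives of bounded exponential order *)

Section Tempered.
Context {R : realType} {P : Type} (D : set P).
Implicit Types (h g : P -> R -> R) (c n : nat).

(** The first [n] derivatives of [h p] are [O(e^(c u))] on [u >= 0], uniformly
    in [p \in D]. The exponent [c] is the same for all orders: this is what
    lets a fixed number of differences beat the growth. Derivatives are required
    on the whole line so that they are two-sided at [0]. *)
Fixpoint tempered c n h : Prop :=
  (exists K, forall p (u : R), D p -> 0 <= u -> `|h p u| <= K * expR (c%:R * u)) /\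
  (if n is n'.+1 then
    exists2 h' : P -> R -> R,
      (forall p (u : R), D p -> is_derive u 1 (h p) (h' p u))
              & tempered c n' h'
   else True).

Lemma tempered_bound c n h : tempered c n h ->
  exists2 K, 0 <= K &
    forall p u, D p -> 0 <= u -> `|h p u| <= K * expR (c%:R * u).
Proof.
move=> th; have [K HK] : exists K, forall p u, D p -> 0 <= u ->
    `|h p u| <= K * expR (c%:R * u) by case: n th => [|n] [].
exists `|K| => // p u Dp u0; apply: le_trans (HK p u Dp u0) _.
by rewrite ler_wpM2r ?expR_ge0 ?ler_norm.
Qed.

Lemma tempered_pred c n h : tempered c n.+1 h -> tempered c n h.
Proof.
elim: n h => [|n IH] h /= [hK [h' dh]]; first by move=> _; split.
by move=> [h'K h'' ]; split => //; exists h' => //; apply: IH; split.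
Qed.

Lemma tempered_weaken c d n h : (c <= d)%N -> tempered c n h -> tempered d n h.
Proof.
move=> cd; elim: n h => [|n IH] h /[dup] /tempered_bound[K K0 HK] th;
    (split; first by exists K => p u Dp u0; apply: le_trans (HK p u Dp u0) _;
      rewrite ler_wpM2l// ler_expR ler_wpM2r// ler_nat) => //.
by case: th => _ [h' dh th']; exists h' => //; exact: IH.
Qed.

Lemma temperedD c n h g : tempered c n h -> tempered c n g ->
  tempered c n (fun p u => h p u + g p u).
Proof.
elim: n h g => [|n IH] h g /[dup] /tempered_bound[K K0 HK] th
    /[dup] /tempered_bound[L L0 HL] tg;
    (split; first by exists (K + L) => p u Dp u0; rewrite mulrDl;
      apply: le_trans (ler_normD _ _) _; rewrite lerD ?HK ?HL) => //.
case: th => _ [h' dh th']; case: tg => _ [g' dg tg'].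
exists (fun p u => h' p u + g' p u); last exact: IH.
by move=> p u Dp; apply: is_deriveD; [exact: dh|exact: dg].
Qed.

Lemma temperedM c d n h g : tempered c n h -> tempered d n g ->
  tempered (c + d) n (fun p u => h p u * g p u).
Proof.
elim: n c d h g => [|n IH] c d h g /[dup] /tempered_bound[K K0 HK] th
    /[dup] /tempered_bound[L L0 HL] tg;
    (split; first by exists (K * L) => p u Dp u0;
      rewrite natrD mulrDl expRD mulrACA normrM ler_pM ?HK ?HL) => //.
case: (th) => _ [h' dh th']; case: (tg) => _ [g' dg tg'].
exists (fun p u => h p u * g' p u + g p u * h' p u).
  by move=> p u Dp; apply: is_deriveM; [exact: dh|exact: dg].
apply: temperedD; first by apply: IH => //; exact: tempered_pred.
by rewrite addnC; apply: IH => //; exact: tempered_pred.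
Qed.

Lemma tempered_cst (k : P -> R) n K : (forall p, D p -> `|k p| <= K) ->
  tempered 0 n (fun p _ => k p).
Proof.
elim: n k K => [|n IH] k K HK;
  (split; first by exists K => p u Dp u0; rewrite mul0r expR0 mulr1 HK) => //.
exists (fun _ _ => 0); first by move=> p u Dp; exact: is_derive_cst.
by apply: (IH _ 0) => p _; rewrite normr0.
Qed.

Lemma temperedZ c n (k : P -> R) K h : (forall p, D p -> `|k p| <= K) ->
  tempered c n h -> tempered c n (fun p u => k p * h p u).
Proof. by move=> Hk Hh; exact: (temperedM (tempered_cst n Hk) Hh). Qed.

Lemma eq_tempered c n h g : (forall p u, D p -> h p u = g p u) ->
  tempered c n h -> tempered c n g.
Proof.
case: n => [|n] hg [[K HK] Hh]; split=> //.
- by exists K => p u Dp u0; rewrite -hg ?HK.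
- by exists K => p u Dp u0; rewrite -hg ?HK.
- case: Hh => h' dh th'; exists h' => // p u Dp.
  have -> : g p = h p by apply/funext => v; rewrite hg.
  exact: dh.
Qed.

Lemma le_MVT (f df : R -> R) (a b M : R) : a <= b ->
  (forall x, a <= x <= b -> is_derive x 1 f (df x)) ->
  (forall x, a <= x <= b -> `|df x| <= M) -> `|f b - f a| <= M * (b - a).
Proof.
move=> ab dfE dfM.
have [x| |c] := @MVT_segment R f df a b ab.
- by rewrite in_itv/= => /andP[ax xb]; apply: dfE; rewrite !ltW.
- apply: derivable_within_continuous => x; rewrite in_itv/= => xab.
  by apply: ex_derive; exact: dfE.
- rewrite in_itv/= => cab ->.
  by rewrite normrM (ger0_norm (_ : 0 <= b - a)) ?subr_ge0// ler_wpM2r ?subr_ge0 ?dfM.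
Qed.

(** Integration costs one unit of exponent, since it multiplies a bound by
    [u <= e^u]. *)
Lemma tempered_primitive c n h h' :
  (forall p, D p -> h p 0 = 0) ->
  (forall p (u : R), D p -> is_derive u 1 (h p) (h' p u)) ->
  tempered c n h' -> tempered c.+1 n.+1 h.
Proof.
move=> h0 dh th'; split; last by exists h' => //; exact: tempered_weaken th'.
have [K K0 HK] := tempered_bound th'.
exists K => p u Dp u0.
have := @le_MVT (h p) (h' p) 0 u (K * expR (c%:R * u)) u0.
rewrite h0// subr0 subr0 => /(_ (fun x _ => dh p x Dp)) /(_ _)/le_trans; apply.
  move=> x /andP[x0 xu]; apply: le_trans (HK p x Dp x0) _.
  by rewrite ler_wpM2l// ler_expR ler_wpM2l.
rewrite -mulrA ler_wpM2l// -addn1 natrD mulrDl mul1r expRD ler_wpM2l ?expR_ge0//.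
by apply: le_trans (expR_ge1Dx u); rewrite lerDr.
Qed.

Lemma tempered_id n : tempered 1 n (fun _ u => u).
Proof.
apply: tempered_pred.
apply: (@tempered_primitive _ _ _ (fun _ _ => 1)) => //.
by apply: (@tempered_cst _ _ 1) => p _; rewrite normr1.
Qed.

(** The real part of [e^(-(s + i t) u)]; its imaginary part is [- expsin s t u]. *)
Definition expcos (s t : R) (u : R) := expR (- (s * u)) * cos (t * u).
Definition expsin (s t : R) (u : R) := expR (- (s * u)) * sin (t * u).

Lemma is_derive_expN (s u : R) :
  is_derive u 1 (fun v => expR (- (s * v))) (expR (- (s * u)) * - s).
Proof.
apply: (@is_derive1_comp _ expR (fun v => - (s * v))).
by apply: is_derive_eq; rewrite -[_ *: _]/(_ * _) mulr1.
Qed.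

Lemma is_derive_expcos (s t u : R) :
  is_derive u 1 (expcos s t) (- s * expcos s t u - t * expsin s t u).
Proof.
rewrite /expcos /expsin.
have d1 := is_derive_expN s u.
have d2 : is_derive u 1 (fun u => cos (t * u)) (- sin (t * u) * t).
  apply: (@is_derive1_comp _ cos (fun u => (t * u))).
  by apply: is_derive_eq; rewrite -[_ *: _]/(_ * _) mulr1.
apply: is_derive_eq; rewrite -![_ *: _]/(_ * _); ring.
Qed.

Lemma is_derive_expsin (s t u : R) :
  is_derive u 1 (expsin s t) (- s * expsin s t u + t * expcos s t u).
Proof.
rewrite /expcos /expsin.
have d1 := is_derive_expN s u.
have d2 : is_derive u 1 (fun u => sin (t * u)) (cos (t * u) * t).
  apply: (@is_derive1_comp _ sin (fun u => (t * u))).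
  by apply: is_derive_eq; rewrite -[_ *: _]/(_ * _) mulr1.
apply: is_derive_eq; rewrite -![_ *: _]/(_ * _); ring.
Qed.

(** The derivatives of [expcos] and [expsin] are linear combinations of the two,
    hence the simultaneous induction. *)
Lemma tempered_expcos_expsin (M n : nat) (s t : P -> R) :
  (forall p, D p -> `|s p| <= M%:R) -> (forall p, D p -> `|t p| <= M%:R) ->
  tempered M n (fun p => expcos (s p) (t p)) /\
  tempered M n (fun p => expsin (s p) (t p)).
Proof.
move=> sM tM.
have expM p u : D p -> 0 <= u -> expR (- (s p * u)) <= expR (M%:R * u).
  move=> Dp u0; rewrite ler_expR -mulNr ler_wpM2r//.
  by apply: le_trans (sM p Dp); rewrite -normrN ler_norm.
have ccos p u : D p -> 0 <= u -> `|expcos (s p) (t p) u| <= 1 * expR (M%:R * u).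
  move=> Dp u0; rewrite /expcos normrM mulrC ler_pM ?normr_ge0//.
    by rewrite ler_norml cos_geN1 cos_le1.
  by rewrite ger0_norm ?expR_ge0 ?expM.
have csin p u : D p -> 0 <= u -> `|expsin (s p) (t p) u| <= 1 * expR (M%:R * u).
  move=> Dp u0; rewrite /expsin normrM mulrC ler_pM ?normr_ge0//.
    by rewrite ler_norml sin_geN1 sin_le1.
  by rewrite ger0_norm ?expR_ge0 ?expM.
have sM' p : D p -> `|- s p| <= M%:R by rewrite normrN; exact: sM.
have tM' p : D p -> `|- t p| <= M%:R by rewrite normrN; exact: tM.
elim: n => [|n [IHc IHs]]; do 2?split => //; try by exists 1.
- exists (fun p u => - s p * expcos (s p) (t p) u - t p * expsin (s p) (t p) u).
    by move=> p u Dp; exact: is_derive_expcos.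
  apply: temperedD; first exact: temperedZ sM' IHc.
  by under eq_fun do under eq_fun do rewrite -mulNr; exact: temperedZ tM' IHs.
- exists (fun p u => - s p * expsin (s p) (t p) u + t p * expcos (s p) (t p) u).
    by move=> p u Dp; exact: is_derive_expsin.
  by apply: temperedD; [exact: temperedZ sM' IHs|exact: temperedZ tM IHc].
Qed.

Lemma is_derive_tanh (x : R) : is_derive x 1 (@tanh R) (1 - tanh x ^+ 2).
Proof.
have dN : is_derive x 1 (fun x : R => expR (- x)) (- expR (- x)).
  rewrite -mulrN1.
  by apply: (@is_derive1_comp _ expR (fun u => - u)); exact: is_deriveNid.
have n0 : expR x + expR (- x) != 0 by rewrite gt_eqF// addr_gt0 ?expR_gt0.
rewrite /tanh.
have dV := @is_deriveV R (fun x => expR x + expR (- x)) x _ 1 n0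
  (is_deriveD (is_derive_expR x) dN).
have := is_deriveM (is_deriveB (is_derive_expR x) dN) dV.
move=> /is_derive_eq; apply; rewrite -![_ *: _]/(_ * _).
by rewrite -[(_ - _) x]/(expR x - expR (- x)); field.
Qed.

Lemma tanh_le1 (x : R) : `|tanh x| <= 1.
Proof.
rewrite /tanh normrM normfV (gtr0_norm (_ : 0 < expR x + expR (- x))).
  rewrite ler_pdivrMr ?mul1r ?addr_gt0 ?expR_gt0//.
  by apply: le_trans (ler_normB _ _) _; rewrite !ger0_norm ?expR_ge0.
by rewrite addr_gt0 ?expR_gt0.
Qed.

Lemma tempered_expN (nu : R) n : 0 < nu ->
  tempered 0 n (fun _ u => expR (- (nu * u))).
Proof.
move=> nu0.
have bd : exists K : R, forall (p : P) u, D p -> 0 <= u ->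
    `|expR (- (nu * u))| <= K * expR (0%:R * u).
  exists 1 => p u Dp u0; rewrite mul0r expR0 mulr1 ger0_norm ?expR_ge0//.
  by rewrite -[leRHS]expR0 ler_expR oppr_le0 mulr_ge0// ltW.
elim: n => [|n IH]; split=> //.
exists (fun _ u => - nu * expR (- (nu * u))).
  by move=> p u _; rewrite mulrC; exact: is_derive_expN.
by apply: (@temperedZ _ _ _ `|nu|) IH => p _; rewrite normrN.
Qed.

(** [tanh] is a bounded solution of [y' = 1 - y^2], so every further derivative
    is a polynomial in bounded functions. *)
Lemma tempered_tanh (h h' : R -> R) n :
  (forall u : R, is_derive u 1 h (h' u)) -> (forall m, tempered 0 m (fun _ => h')) ->
  tempered 0 n (fun _ u => tanh (h u)).
Proof.
move=> dh th'.
have bd : exists K : R, forall (p : P) u, D p -> 0 <= u ->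
    `|tanh (h u)| <= K * expR (0%:R * u).
  by exists 1 => p u Dp u0; rewrite mul0r expR0 mulr1 tanh_le1.
elim: n => [|n IH]; split=> //.
exists (fun _ u => (1 + (-1) * (tanh (h u) * tanh (h u))) * h' u).
  move=> p u _; rewrite mulN1r -expr2.
  exact: (is_derive1_comp (is_derive_tanh _)).
apply: (@temperedM 0 0) => //.
apply: temperedD; first by apply: (@tempered_cst _ _ 1) => p _; rewrite normr1.
apply: (@temperedZ _ _ _ 1); first by move=> p _; rewrite normrN1.
exact: (@temperedM 0 0).
Qed.

(** The damping factor of the series as a function of [u = ln (m + 1)]. *)
Definition etaG (kappa nu u : R) : R :=
  B kappa (expR (- (nu * u))) / B kappa 0.

Lemma tempered_etaG (kappa nu : R) n : 0 < nu ->
  tempered 0 n (fun _ => etaG kappa nu).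
Proof.
move=> nu0; pose y (u : R) := expR (- (nu * u)).
have H e : tempered 0 n (fun _ u => tanh ((y u + e) / kappa)).
  apply: (@tempered_tanh _ (fun u => - nu / kappa * y u)) => [u|m]; last first.
    by apply: (@temperedZ _ _ _ `|- nu / kappa|) => //; exact: tempered_expN.
  have dy : is_derive u 1 y (expR (- (nu * u)) * - nu) by exact: is_derive_expN.
  have -> : (fun u => (y u + e) / kappa) = (kappa^-1 \*: (y + cst e)).
    by apply/funext => v /=; rewrite -[_ *: _]/(_ * _) mulrC.
  by apply: is_derive_eq; rewrite -[_ *: _]/(_ * _) addr0 /y; ring.
have := temperedZ (k := fun _ => (2 * B kappa 0)^-1) (fun _ _ => lexx _)
  (temperedD (H 2^-1)
  (temperedZ (k := fun _ => -1) (fun _ _ => lexx _) (H (- 2^-1)))).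
apply: eq_tempered => p u _; rewrite /etaG {2}/B /y invfM; ring.
Qed.
End Tempered.

(** * Differences and the Euler transform *)

Section FiniteDifferences.
Context {R : realType}.

(** Differences are taken with the sign [f x - f (x + 1)], which absorbs the
    alternating sign of the series. *)
Definition fdiff (f : R -> R) (x : R) : R := f x - f (x + 1).

Definition ndiff (f : nat -> R) (n : nat) : R := f n - f n.+1.

(** Induction on [p]: the sequence [fdiff (F i)] is again a chain of
    derivatives, one term shorter, and its last term is controlled by
    [F p] through the mean value theorem. *)
Lemma iter_fdiff_le p (F : nat -> R -> R) (b : R -> R) :
  (forall i (x : R), (i < p)%N -> 0 < x -> is_derive x 1 (F i) (F i.+1 x)) ->
  (forall x, 1 <= x -> `|F p x| <= b x) ->
  (forall x y, 1 <= x -> x <= y -> b y <= b x) ->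
  forall x, 1 <= x -> `|iter p fdiff (F 0%N) x| <= b x.
Proof.
move=> + + bni; elim: p F => [//|p IH] F dF Fb x x1.
rewrite iterSr; apply: (IH (fun i => fdiff (F i))) => // [i y ip y0|y y1].
  rewrite /fdiff; have y10 : 0 < y + 1 by rewrite addr_gt0.
  have d1 := dF i y (ltnW ip) y0.
  have d2 : is_derive y 1 (F i \o (fun z => z + 1)) (F i.+1 (y + 1) * 1).
    apply: is_derive1_comp; first exact: dF (ltnW ip) y10.
    by apply: is_derive_eq; rewrite addr0.
  by rewrite mulr1 in d2; exact: is_deriveB.
rewrite /fdiff distrC.
have := @le_MVT R (F p) (F p.+1) y (y + 1) (b y).
rewrite addrAC subrr add0r mulr1; apply; first by rewrite lerDl.
- move=> z /andP[yz _]; apply: dF => //.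
  by rewrite (lt_le_trans _ yz)// (lt_le_trans _ y1).
- move=> z /andP[yz _]; apply: le_trans (Fb z (le_trans y1 yz)) _.
  exact: bni.
Qed.

Lemma iter_fdiff_natE p (f : R -> R) n :
  iter p fdiff f n.+1%:R = iter p ndiff (fun m => f m.+1%:R) n.
Proof.
elim: p n => [//|p IH] n.
by rewrite !iterS /fdiff /ndiff -!IH natr1.
Qed.

(** Differentiating [x^(-a) h(ln x)] gives [x^(-a-1) (h' - a h)(ln x)], a function
    of the same shape. Carrying the weight [a] through the induction therefore
    produces all derivatives of [h (ln x)], each gaining one power of [x]. *)
Lemma tempered_log_derivatives {P : Type} (D : set P) c p a (h : P -> R -> R) :
  tempered D c p h ->
  exists F : nat -> P -> R -> R,
  [/\ F 0%N = (fun q x => expR (- (a%:R * ln x)) * h q (ln x)),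
      forall i q (x : R), (i < p)%N -> D q -> 0 < x ->
        is_derive x 1 (F i q) (F i.+1 q x) &
      exists2 K, 0 <= K & forall q x, D q -> 1 <= x ->
        `|F p q x| <= K * expR ((c%:R - (a + p)%:R) * ln x)].
Proof.
elim: p a h => [|p IH] a h; move=> /[dup] th /tempered_bound[K K0 hK].
  exists (fun _ q x => expR (- (a%:R * ln x)) * h q (ln x)); split => //.
  exists K => // q x Dq x1; rewrite normrM ger0_norm ?expR_ge0// addn0 addrC.
  rewrite mulrDl expRD mulrCA mulNr ler_wpM2l ?expR_ge0//.
  by rewrite hK// ln_ge0.
case: th => _ [h' dh th'].
have thp : tempered D c p h.
  by apply: tempered_pred; split; [exists K|exists h'].
have [] := IH a.+1 (fun q u => h' q u + - a%:R * h q u).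
  apply: temperedD => //.
  by apply: (@temperedZ _ _ _ _ _ (fun _ => - a%:R) `|a%:R|) => // q _; rewrite normrN.
move=> G [G0 dG [L L0 GL]].
exists (fun i => if i is j.+1 then G j
   else (fun q x => expR (- (a%:R * ln x)) * h q (ln x))); split => //.
- case=> [|i] q x ip Dq x0; last exact: dG.
  rewrite G0.
  have dln := is_derive1_ln x0.
  have d1 : is_derive x 1 (fun x => expR (- (a%:R * ln x)))
      (expR (- (a%:R * ln x)) * (- a%:R * x^-1)).
    have := is_derive1_comp (is_derive_expN a%:R (ln x)) dln.
    by rewrite -mulrA.
  have d2 := is_derive1_comp (dh q (ln x) Dq) dln.
  apply: (is_derive_eq (is_deriveM d1 d2)); rewrite -![_ *: _]/(_ * _)/=.
  have -> : expR (- (a.+1%:R * ln x)) = expR (- (a%:R * ln x)) * x^-1.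
    by rewrite -natr1 mulrDl mul1r opprD expRD (expRN (ln x)) lnK.
  ring.
- by exists L => // q x Dq x1; rewrite addnS -addSn GL.
Qed.

(** Each difference divides the growth [O(x^c)] by [x]: [c] of them cancel the
    growth, and two more make the values summable. *)
Lemma tempered_ndiff_le {P : Type} (D : set P) c (h : P -> R -> R) :
  tempered D c c.+2 h ->
  exists2 K, 0 <= K & forall q j, D q ->
    `|iter c.+2 ndiff (fun m => h q (ln m.+1%:R)) j| <= K / j.+1%:R ^+ 2.
Proof.
move=> /(tempered_log_derivatives 0)[F [F0 dF [K K0 FK]]].
exists K => // q j Dq.
rewrite -(iter_fdiff_natE c.+2 (fun x => h q (ln x))).
have -> : (fun x => h q (ln x)) = F 0%N q.
  by rewrite F0; apply/funext => x; rewrite mul0r oppr0 expR0 mul1r.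
have FK' x : 1 <= x -> `|F c.+2 q x| <= K / x ^+ 2.
  move=> x1; apply: le_trans (FK q x Dq x1) _; rewrite ler_wpM2l//.
  have -> : c%:R - (0 + c.+2)%:R = - 2%:R :> R.
    by rewrite add0n -addn2 natrD opprD addrA subrr add0r.
  have x0 : 0 < x by exact: lt_le_trans x1.
  by rewrite mulNr expRN mulrC expRM_natr lnK.
apply: (@iter_fdiff_le _ (fun i => F i q) (fun x => K / x ^+ 2)) => //.
- by move=> i x ip x0; exact: dF.
- move=> x y x1 xy; rewrite ler_wpM2l//.
  have x0 : 0 < x by exact: lt_le_trans x1.
  have y0 : 0 < y by exact: lt_le_trans xy.
  by rewrite lef_pV2 ?posrE ?exprn_gt0// lerXn2r// ?nnegrE ltW.
- by rewrite ler1n.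
Qed.

Lemma iter_ndiffE (f : nat -> R) k n :
  iter k ndiff f n =
  \sum_(0 <= m < k.+1) 'C(k, m)%:R * (-1) ^+ m * f (n + m)%N.
Proof.
elim: k n => [|k IH] n.
  by rewrite big_nat1 addn0 bin0 expr0 !mul1r.
rewrite iterS /ndiff !IH [RHS]big_nat_recl// [X in X - _]big_nat_recl//.
rewrite !bin0 -addrA; congr (_ + _).
under [RHS]eq_bigr do rewrite binS natrD !mulrDl.
rewrite big_split/=; congr (_ + _).
  by rewrite [RHS]big_nat_recr//= bin_small// !mul0r addr0.
rewrite -sumrN; apply: eq_bigr => i _.
by rewrite exprS addnS -addSn; ring.
Qed.

Definition euler_term (f : nat -> R) (k : nat) : R :=
  (2 ^+ k.+1)^-1 * \sum_(0 <= m < k.+1) 'C(k, m)%:R * (-1) ^+ m * f m.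

Lemma sum_bin_nat n : \sum_(0 <= i < n.+1) 'C(n, i)%:R = 2 ^+ n :> R.
Proof.
rewrite -natr_sum big_mkord -natrX; congr (_ %:R).
by rewrite (Pascal 1 1 n); apply: eq_bigr => i _; rewrite !exp1n !muln1.
Qed.

(** [1/(j+1)^2 <= 2/((j+1)(j+2))], and dividing [binom(n,j)] by [(j+1)(j+2)]
    gives [binom(n+2,j+2) / ((n+1)(n+2))]. *)
Lemma sum_bin_div_sq_le n :
  \sum_(0 <= j < n.+1) 'C(n, j)%:R / j.+1%:R ^+ 2
    <= 2 ^+ n.+3 / (n.+1 * n.+2)%:R :> R.
Proof.
apply: (@le_trans _ _ (\sum_(0 <= j < n.+1)
    2 * 'C(n.+2, j.+2)%:R / (n.+1 * n.+2)%:R)).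
  apply: ler_sum => j _.
  have -> : 'C(n.+2, j.+2)%:R = (n.+1 * n.+2)%:R * 'C(n, j)%:R / (j.+1 * j.+2)%:R :> R.
    apply: (canRL (mulfK _)); first by rewrite pnatr_eq0.
    rewrite -!natrM; congr (_%:R).
    have e1 := mul_bin_diag n.+2 j.+1; have e2 := mul_bin_diag n.+1 j.
    rewrite /= in e1 e2.
    by rewrite mulnC -mulnA -e1 mulnCA -e2 mulnCA mulnA.
  rewrite -[X in _ <= X]mulrA [X in 2 * X](_ : _ = 'C(n, j)%:R / (j.+1 * j.+2)%:R); last first.
    by rewrite mulrC mulrA mulrA mulVf ?pnatr_eq0// mul1r.
  rewrite mulrCA ler_wpM2l// -[leLHS]mul1r ler_pdivrMr ?exprn_gt0//.
  rewrite mulrAC ler_pdivlMr ?ltr0n// mul1r -natrX -natrM ler_nat expnS expn1; lia.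
rewrite -mulr_suml -mulr_sumr ler_wpM2r// exprS ler_wpM2l// -sum_bin_nat.
by rewrite [leRHS]big_nat_recl// [X in _ + X]big_nat_recl// addrA lerDr.
Qed.

(** For [k >= c+2] the [k]-th difference is the [(k-c-2)]-th difference of a
    sequence that is [O(j^-2)]. The finitely many smaller [k] only enlarge the
    constant. *)
Lemma euler_term_le {P : Type} (D : set P) c (h : P -> R -> R) :
  tempered D c c.+2 h ->
  exists2 K, 0 <= K & forall q k, D q ->
    `|euler_term (fun m => h q (ln m.+1%:R)) k| <= K / (k.+1 * k.+2)%:R.
Proof.
move=> /[dup] /tempered_ndiff_le[K K0 hK] /tempered_bound[L L0 hL].
set p := c.+2 in hK *.
(* [L'] bounds the sampled values that enter the terms of index [k < p]. *)
pose L' := L * expR (c%:R * ln p%:R).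
have L'0 : 0 <= L' by rewrite mulr_ge0// expR_ge0.
exists ((4 * K + L') * (p.+1 ^ 2)%:R) => [|q k Dq].
  by rewrite mulr_ge0// addr_ge0// mulr_ge0.
have [kp|pk] := ltnP k p.
  apply: (@le_trans _ _ L').
    rewrite /euler_term normrM ger0_norm ?invr_ge0 ?exprn_ge0//.
    rewrite mulrC ler_pdivrMr ?exprn_gt0//.
    apply: le_trans (ler_norm_sum _ _ _) _.
    apply: (@le_trans _ _ (\sum_(0 <= m < k.+1) 'C(k, m)%:R * L')).
      apply: ler_sum_nat => m /andP[_ mk].
      rewrite !normrM normrX normrN1 expr1n mulr1 normr_nat ler_wpM2l//.
      apply: le_trans (hL q _ Dq _) _; first by rewrite ln_ge0// ler1n.
      rewrite ler_wpM2l// ler_expR ler_wpM2l// ler_ln ?posrE ?ltr0n// ler_nat.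
      exact: leq_trans mk kp.
    by rewrite -mulr_suml sum_bin_nat mulrC ler_wpM2l// ler_weXn2l// ler1n.
  rewrite ler_pdivlMr ?ltr0n// ler_pM// ?lerDr ?mulr_ge0// ler_nat expnS expn1.
  by rewrite leq_mul//; lia.
have [n kE] : exists n, k = (n + p)%N by exists (k - p)%N; rewrite subnK.
have -> : euler_term (fun m => h q (ln m.+1%:R)) k =
    (2 ^+ k.+1)^-1 * \sum_(0 <= j < n.+1) 'C(n, j)%:R * (-1) ^+ j *
      iter p ndiff (fun m => h q (ln m.+1%:R)) j.
  rewrite /euler_term; congr (_ * _).
  have <- := iter_ndiffE (fun m => h q (ln m.+1%:R)) k 0.
  by rewrite kE iterD iter_ndiffE.
rewrite normrM ger0_norm ?invr_ge0 ?exprn_ge0//.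
apply: (@le_trans _ _ ((2 ^+ k.+1)^-1 * (K * (2 ^+ n.+3 / (n.+1 * n.+2)%:R)))).
  rewrite ler_wpM2l ?invr_ge0 ?exprn_ge0//.
  apply: le_trans (ler_wpM2l K0 (sum_bin_div_sq_le n)).
  rewrite mulr_sumr; apply: le_trans (ler_norm_sum _ _ _) _.
  apply: ler_sum => j _; rewrite !normrM normrX normrN1 expr1n mulr1 normr_nat.
  by rewrite mulrCA ler_wpM2l// hK.
have -> : (2 ^+ k.+1)^-1 * (K * (2 ^+ n.+3 / (n.+1 * n.+2)%:R)) =
    (K / 2 ^+ c) / (n.+1 * n.+2)%:R :> R.
  rewrite kE /p.
  have -> : (2 : R) ^+ (n + c.+2).+1 = 2 ^+ n.+3 * 2 ^+ c.
    by rewrite -exprD; congr (_ ^+ _); lia.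
  move: (2 ^+ n.+3) (2 ^+ c) (exprn_gt0 n.+3 (ltr0n R 2)) (exprn_gt0 c (ltr0n R 2)) => x y x0 y0.
  by rewrite invfM [K * _]mulrCA mulrACA mulVf ?gt_eqF// mul1r mulrCA mulrA.
rewrite ler_pdivrMr ?ltr0n// mulrAC ler_pdivlMr ?ltr0n//.
rewrite -[leRHS]mulrA ler_pM ?divr_ge0 ?exprn_ge0//.
  apply: (@le_trans _ _ (4 * K)); last by rewrite lerDl.
  apply: (@le_trans _ _ K); last by rewrite ler_peMl// ler1n.
  by rewrite ler_pdivrMr ?exprn_gt0// ler_peMr// exprn_ege1// ler1n.
rewrite -natrM ler_nat kE expnS expn1.
by nia.
Qed.
End FiniteDifferences.

(** * The Taylor remainder of the exponential *)

Section Families.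
Context {R : realType}.
Implicit Types (q : R * R * R) (u : R).

(** The triple [(r, a, b)] stands for the increment [r (a + i b)]. Keeping the
    size [r] apart from the direction lets the remainder be divided by
    [r ^+ 2] with bounds that do not depend on [r]. *)
Definition small_polar : set (R * R * R) :=
  [set q | 0 < q.1.1 /\ [/\ q.1.1 <= 1, `|q.1.2| <= 1 & `|q.2| <= 1]].

(** Real and imaginary parts of [(e^(-z u) - 1 + z u) / r^2] for
    [z = r (a + i b)]. *)
Definition rem_re q u : R :=
  (expcos (q.1.1 * q.1.2) (q.1.1 * q.2) u - 1 + q.1.1 * q.1.2 * u) / q.1.1 ^+ 2.

Definition rem_im q u : R :=
  (- expsin (q.1.1 * q.1.2) (q.1.1 * q.2) u + q.1.1 * q.2 * u) / q.1.1 ^+ 2.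

(** With [w = z / r], the function [X = (e^(-z u) - 1) / r] has derivative
    [- w e^(-z u)], and the remainder [(e^(-z u) - 1 + z u) / r^2] has derivative
    [- w X]; both vanish at [0]. Integrating twice thus absorbs both divisions by
    [r], as [|a|, |b| <= 1]. *)
Lemma tempered_rem n :
  tempered small_polar 3 n rem_re /\ tempered small_polar 3 n rem_im.
Proof.
pose c q := expcos (q.1.1 * q.1.2) (q.1.1 * q.2).
pose s q := expsin (q.1.1 * q.1.2) (q.1.1 * q.2).
have a1 q : small_polar q -> `|q.1.2| <= 1 by case=> _ [].
have b1 q : small_polar q -> `|q.2| <= 1 by case=> _ [].
have Na1 q : small_polar q -> `|- q.1.2| <= 1 by rewrite normrN; exact: a1.
have Nb1 q : small_polar q -> `|- q.2| <= 1 by rewrite normrN; exact: b1.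
have r0 q : small_polar q -> q.1.1 != 0 by case=> r0 _; rewrite gt_eqF.
have c0 q : c q 0 = 1 by rewrite /c /expcos !mulr0 oppr0 expR0 cos0 mulr1.
have s0 q : s q 0 = 0 by rewrite /s /expsin !mulr0 sin0 mulr0.
have prod1 q x : small_polar q -> `|x| <= 1 -> `|q.1.1 * x| <= 1.
  move=> [q0 [q1 _ _]] x1; rewrite normrM gtr0_norm//.
  by rewrite -[leRHS]mulr1 ler_pM// ltW.
have [tc ts] : (forall m, tempered small_polar 1 m c) /\
    forall m, tempered small_polar 1 m s.
  by split=> m; have [] := @tempered_expcos_expsin R _ small_polar 1 m
    (fun q => q.1.1 * q.1.2) (fun q => q.1.1 * q.2)
    (fun q Dq => prod1 q _ Dq (a1 q Dq)) (fun q Dq => prod1 q _ Dq (b1 q Dq)).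
have dc q u : is_derive u 1 (c q)
    (- (q.1.1 * q.1.2) * c q u - q.1.1 * q.2 * s q u) by exact: is_derive_expcos.
have ds q u : is_derive u 1 (s q)
    (- (q.1.1 * q.1.2) * s q u + q.1.1 * q.2 * c q u) by exact: is_derive_expsin.
(* [xr] and [xi] are the real and imaginary parts of [X]. *)
pose xr q u := q.1.1^-1 * (c q u - 1).
pose xi q u := q.1.1^-1 * (- s q u).
have tcomb k m (f g : R * R * R -> R) (h1 h2 : R * R * R -> R -> R) :
    (forall q, small_polar q -> `|f q| <= 1) ->
    (forall q, small_polar q -> `|g q| <= 1) ->
    tempered small_polar k m h1 -> tempered small_polar k m h2 ->
    tempered small_polar k m (fun q u => f q * h1 q u + g q * h2 q u).
  by move=> f1 g1 t1 t2; apply: temperedD; [exact: temperedZ f1 t1|exact: temperedZ g1 t2].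
have txr m : tempered small_polar 2 m xr.
  apply: tempered_pred.
  apply: (@tempered_primitive _ _ _ _ _ _ (fun q u => - q.1.2 * c q u + - q.2 * s q u)).
  - by move=> q _; rewrite /xr c0 subrr mulr0.
  - move=> q u Dq; rewrite /xr; have r := r0 q Dq.
    have d := is_deriveZ (q.1.1^-1) (is_deriveB (dc q u) (is_derive_cst (1 : R) u 1)).
    by apply: (is_derive_eq d); rewrite -[_ *: _]/(_ * _); field.
  - exact: tcomb.
have txi m : tempered small_polar 2 m xi.
  apply: tempered_pred.
  apply: (@tempered_primitive _ _ _ _ _ _ (fun q u => q.1.2 * s q u + - q.2 * c q u)).
  - by move=> q _; rewrite /xi s0 oppr0 mulr0.
  - move=> q u Dq; rewrite /xi; have r := r0 q Dq.
    have d := is_deriveZ (q.1.1^-1) (is_deriveN (ds q u)).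
    by apply: (is_derive_eq d); rewrite -[_ *: _]/(_ * _); field.
  - exact: tcomb.
split; apply: tempered_pred.
- apply: (@tempered_primitive _ _ _ _ _ _ (fun q u => - q.1.2 * xr q u + q.2 * xi q u)).
  + by move=> q _; rewrite /rem_re -/(c q) c0 subrr mulr0 addr0 mul0r.
  + move=> q u Dq; have r := r0 q Dq.
    have -> : rem_re q = (q.1.1 ^- 2 \*: (c q - cst 1 + (q.1.1 * q.1.2) \*: id)).
      by apply/funext => v; rewrite /rem_re mulrC.
    by apply: is_derive_eq; rewrite -![_ *: _]/(_ * _) /xr /xi; field.
  + exact: (tcomb _ _ (fun q => - q.1.2) (fun q => q.2) xr xi).
- apply: (@tempered_primitive _ _ _ _ _ _ (fun q u => - q.1.2 * xi q u + - q.2 * xr q u)).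
  + by move=> q _; rewrite /rem_im -/(s q) s0 oppr0 mulr0 addr0 mul0r.
  + move=> q u Dq; have r := r0 q Dq.
    have -> : rem_im q = (q.1.1 ^- 2 \*: (- s q + (q.1.1 * q.2) \*: id)).
      by apply/funext => v; rewrite /rem_im mulrC.
    by apply: is_derive_eq; rewrite -![_ *: _]/(_ * _) /xr /xi; field.
  + exact: (tcomb _ _ (fun q => - q.1.2) (fun q => - q.2) xi xr).
Qed.

End Families.

(** * Bounds on the terms of the series *)

Section EtaTerm.
Context {R : realType} (kappa nu : R).
Local Notation C := (R[i]^o).

Lemma euler_termD (f g : nat -> R) k :
  euler_term (fun m => f m + g m) k = euler_term f k + euler_term g k.
Proof.
by rewrite /euler_term -mulrDr -big_split/=; under eq_bigr do rewrite mulrDr.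
Qed.

Lemma euler_termZ (x : R) (f : nat -> R) k :
  euler_term (fun m => x * f m) k = x * euler_term f k.
Proof.
rewrite /euler_term [RHS]mulrCA; congr (_ * _); rewrite mulr_sumr.
by apply: eq_bigr => i _; rewrite mulrCA.
Qed.

Definition ceuler_term (f g : R -> R) (k : nat) : C :=
  euler_term (fun m => f (ln m.+1%:R)) k +i* euler_term (fun m => g (ln m.+1%:R)) k.

Lemma norm_complex_le (x y : R) : `|(x +i* y : R[i])| <= (`|x| + `|y|)%:C.
Proof.
rewrite normc_def lecR -[leRHS]ger0_norm ?addr_ge0// -sqrtr_sqr.
rewrite ler_sqrt ?sqr_ge0// sqrrD !real_normK ?num_real//=.
by rewrite addrAC lerDl mulrn_wge0// mulr_ge0.
Qed.

Lemma norm_complex_ge_Im (z : R[i]) : `|complex.Im z|%:C <= `|z|.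
Proof.
by rewrite normc_def lecR -sqrtr_sqr ler_sqrt ?addr_ge0 ?sqr_ge0// lerDr sqr_ge0.
Qed.

Lemma ceuler_term_le {P : Type} (D : set P) c (f g : P -> R -> R) :
  (forall n, tempered D c n f) -> (forall n, tempered D c n g) ->
  exists2 K, 0 <= K & forall p k, D p ->
    `|ceuler_term (f p) (g p) k| <= (K / (k.+1 * k.+2)%:R)%:C.
Proof.
move=> /(_ c.+2)/euler_term_le[K K0 HK] /(_ c.+2)/euler_term_le[L L0 HL].
exists (K + L); first exact: addr_ge0.
move=> p k Dp; apply: le_trans (norm_complex_le _ _) _.
by rewrite lecR mulrDl lerD ?HK ?HL.
Qed.

Definition eta_re (s : C) (u : R) : R :=
  expcos (complex.Re s) (complex.Im s) u * etaG kappa nu u.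

Definition eta_im (s : C) (u : R) : R :=
  - expsin (complex.Re s) (complex.Im s) u * etaG kappa nu u.

Lemma rpowCV (s : C) m : (rpowC m.+1%:R s)^-1 =
  expcos (complex.Re s) (complex.Im s) (ln m.+1%:R)
  -i* expsin (complex.Re s) (complex.Im s) (ln m.+1%:R).
Proof.
case: s => x y; rewrite /rpowC /expC /expcos /expsin /=.
rewrite !mulr0 subr0 add0r.
set u := ln _; have e0 := expR_gt0 (x * u); have cs := cos2Dsin2 (y * u).
have n0 : (expR (x * u) * cos (y * u)) +i* (expR (x * u) * sin (y * u)) != 0 :> R[i].
  apply/negP => /eqP[] /eqP; rewrite mulf_eq0 gt_eqF//= => /eqP c0 /eqP.
  rewrite mulf_eq0 gt_eqF//= => /eqP s0; move: cs.
  by rewrite c0 s0 expr0n addr0 => /esym/eqP; rewrite oner_eq0.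
apply: (mulIf n0); rewrite mulVf// expRN.
apply/eqP; rewrite eq_complex/=; apply/andP; split; apply/eqP.
  by rewrite -cs; field; rewrite gt_eqF.
by field; rewrite gt_eqF.
Qed.

Lemma Re_mulrC (x : R) (z : R[i]) : complex.Re (x%:C * z) = x * complex.Re z.
Proof. by case: z => a b /=; rewrite mul0r subr0. Qed.

Lemma Im_mulrC (x : R) (z : R[i]) : complex.Im (x%:C * z) = x * complex.Im z.
Proof. by case: z => a b /=; rewrite mul0r addr0. Qed.

Lemma eta_termE k (s : C) :
  eta_term kappa nu k s = ceuler_term (eta_re s) (eta_im s) k.
Proof.
have tE m : 'C(k, m)%:R * ((-1) ^+ m / rpowC m.+1%:R s) *
     (B kappa (m.+1%:R `^ nu)^-1 / B kappa 0)%:C =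
   ('C(k, m)%:R * (-1) ^+ m)%:C *
     (eta_re s (ln m.+1%:R) +i* eta_im s (ln m.+1%:R)) :> R[i].
  have -> : ('C(k, m)%:R * (-1) ^+ m)%:C = 'C(k, m)%:R * (-1) ^+ m :> R[i].
    by rewrite rmorphM rmorphXn rmorphN1 rmorph_nat.
  rewrite rpowCV /eta_re /eta_im /etaG.
  have -> : expR (- (nu * ln m.+1%:R)) = (m.+1%:R `^ nu)^-1 :> R.
    by rewrite expRN /powR pnatr_eq0.
  rewrite -mulrA -(mulrA ((-1) ^+ m)) mulrA; congr (_ * _).
  rewrite mulrC; apply/eqP; rewrite eq_complex/= !mul0r subr0 addr0.
  by apply/andP; split; apply/eqP; ring.
rewrite /eta_term /ceuler_term /euler_term.
have two : (2 ^+ k.+1)^-1 = ((2 ^+ k.+1)^-1 : R)%:C :> R[i].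
  by rewrite rmorphV ?unitfE ?expf_neq0// rmorphXn rmorph_nat.
under eq_bigr do rewrite tE.
rewrite -[LHS]/((2 ^+ k.+1)^-1 * _ : R[i]) two.
apply/eqP; rewrite eq_complex Re_mulrC Im_mulrC/=; apply/andP; split; apply/eqP.
  congr (_ * _); rewrite (big_morph (@complex.Re R) (id1 := 0) (op1 := +%R))//.
  by apply: eq_bigr => m _; rewrite Re_mulrC.
  by case=> ? ? [].
congr (_ * _); rewrite (big_morph (@complex.Im R) (id1 := 0) (op1 := +%R))//.
  by apply: eq_bigr => m _; rewrite Im_mulrC.
by case=> ? ? [].
Qed.

Context (nu_gt0 : 0 < nu).

Lemma tempered_eta {P : Type} (D : set P) (s : P -> C) (M : nat) :
  (forall p, D p -> `|complex.Re (s p)| <= M%:R) ->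
  (forall p, D p -> `|complex.Im (s p)| <= M%:R) ->
  (forall n, tempered D M n (fun p => eta_re (s p))) /\
  (forall n, tempered D M n (fun p => eta_im (s p))).
Proof.
move=> hr hi; split => n; have [tc ts] := tempered_expcos_expsin n hr hi;
  have tG := tempered_etaG D kappa n nu_gt0.
  by have := temperedM tc tG; rewrite addn0.
have N1 (p : P) : D p -> `|-1 : R| <= 1 by rewrite normrN1.
have := temperedM (temperedZ N1 ts) tG; rewrite addn0.
by apply: eq_tempered => p u _; rewrite mulN1r.
Qed.

Lemma eta_term_le (M : nat) : exists2 K, 0 <= K & forall (s : C) k,
  `|complex.Re s| <= M%:R -> `|complex.Im s| <= M%:R ->
  `|eta_term kappa nu k s| <= (K / (k.+1 * k.+2)%:R)%:C.
Proof.
pose D : set C := [set s | `|complex.Re s| <= M%:R /\ `|complex.Im s| <= M%:R].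
have [tr ti] := @tempered_eta C D id M (fun s => @proj1 _ _) (fun s => @proj2 _ _).
have [K K0 HK] := ceuler_term_le tr ti.
by exists K => // s k sr si; rewrite eta_termE HK.
Qed.

(** The derivative of [eta_term] in [s]: each [(m+1)^(-s)] contributes a factor
    [- ln (m+1)]. *)
Definition eta_dterm (k : nat) (s : C) : C :=
  ceuler_term (fun u => - u * eta_re s u) (fun u => - u * eta_im s u) k.

Lemma tempered_eta_at (s : C) : exists M : nat, forall (P : Type) (D : set P),
  (forall n, tempered D M n (fun _ => eta_re s)) /\
  (forall n, tempered D M n (fun _ => eta_im s)).
Proof.
exists (Num.bound (`|complex.Re s| + `|complex.Im s|)) => P D.
have le : `|complex.Re s| + `|complex.Im s| <=
   (Num.bound (`|complex.Re s| + `|complex.Im s|))%:R.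
  by rewrite ltW// archi_boundP// addr_ge0.
apply: (@tempered_eta P D (fun _ => s)) => p _; apply: le_trans le.
  by rewrite lerDl.
by rewrite lerDr.
Qed.

Lemma eta_dterm_le (s : C) : exists2 K, 0 <= K & forall k,
  `|eta_dterm k s| <= (K / (k.+1 * k.+2)%:R)%:C.
Proof.
have [M /(_ unit setT)[tr ti]] := tempered_eta_at s.
have tN n : tempered [set: unit] 1 n (fun _ (u : R) => - u).
  apply: eq_tempered (temperedZ (K := 1) (k := fun _ => -1) _ (tempered_id _ n)).
    by move=> p u _; rewrite mulN1r.
  by move=> p _; rewrite normrN1.
have [K K0 HK] := ceuler_term_le (fun n => temperedM (tN n) (tr n))
  (fun n => temperedM (tN n) (ti n)).
by exists K => // k; exact: (HK tt).
Qed.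

(** Complex Taylor expansion of the terms at [s], with the constant of
    [euler_term_le] for the family of remainders. *)
Lemma eta_term_taylor_le (s : C) : exists2 K, 0 <= K & forall k (z : C) (r : R),
  `|z| = r%:C -> 0 < r -> r <= 1 ->
  `|eta_term kappa nu k (z + s) - eta_term kappa nu k s - z * eta_dterm k s|
    <= (K * r ^+ 2 / (k.+1 * k.+2)%:R)%:C.
Proof.
have [M /(_ _ (@small_polar R))[tr ti]] := tempered_eta_at s.
have trem n := (@tempered_rem R n).1; have tiem n := (@tempered_rem R n).2.
(* [f + i g] is the product of [e^(-s u) G u] with [rem_re + i rem_im]. *)
pose f (q : R * R * R) u := eta_re s u * rem_re q u + -1 * (eta_im s u * rem_im q u).
pose g (q : R * R * R) u := eta_re s u * rem_im q u + eta_im s u * rem_re q u.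
have [] := @ceuler_term_le _ (@small_polar R) (M + 3) f g.
- move=> n; apply: temperedD; first exact: temperedM.
  apply: (temperedZ (k := fun _ => -1) (K := 1)); last exact: temperedM.
  by move=> q _; rewrite normrN1.
- by move=> n; apply: temperedD; exact: temperedM.
move=> K K0 HK; exists K => // k z r zr r0 r1.
pose q := (r, complex.Re z / r, complex.Im z / r).
have abs_le1 x : `|x| <= r -> `|x / r| <= 1.
  by move=> xr; rewrite normrM normfV (gtr0_norm r0) ler_pdivrMr// mul1r.
have Dq : small_polar q.
  split=> //; split=> //; apply: abs_le1; rewrite -lecR -zr.
    exact: normc_ge_Re.
  exact: norm_complex_ge_Im.
rewrite [K * _]mulrC -mulrA rmorphM/=.
have -> : eta_term kappa nu k (z + s) - eta_term kappa nu k s - z * eta_dterm k s =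
    (r ^+ 2)%:C * ceuler_term (f q) (g q) k; last first.
  rewrite normrM (ger0_norm (_ : 0 <= (r ^+ 2)%:C)) ?lecR ?sqr_ge0//.
  by apply: ler_wpM2l; [rewrite lecR sqr_ge0|exact: HK].
rewrite !eta_termE /eta_dterm /ceuler_term.
have rn0 : r != 0 by rewrite gt_eqF.
have qz : (r * (complex.Re z / r) = complex.Re z) * (r * (complex.Im z / r) = complex.Im z).
  by split; field.
have reE u : eta_re (z + s) u = eta_re s u + complex.Re z * (- u * eta_re s u)
   + (- complex.Im z * (- u * eta_im s u) + r ^+ 2 * f q u).
  rewrite /f /rem_re /rem_im /= !qz.
  rewrite /eta_re /eta_im /expcos /expsin.
  case: {zr Dq q qz} z => z1 z2; case: {tr ti f g HK} s => s1 s2 /=.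
  rewrite !mulrDl opprD expRD cosD; field.
  exact: rn0.
have imE u : eta_im (z + s) u = eta_im s u + complex.Re z * (- u * eta_im s u)
   + (complex.Im z * (- u * eta_re s u) + r ^+ 2 * g q u).
  rewrite /g /rem_re /rem_im /= !qz.
  rewrite /eta_re /eta_im /expcos /expsin.
  case: {zr Dq q qz reE} z => z1 z2; case: {tr ti f g HK} s => s1 s2 /=.
  rewrite !mulrDl opprD expRD sinD; field.
  exact: rn0.
have -> : (fun m => eta_re (z + s) (ln m.+1%:R)) =
    (fun m => eta_re s (ln m.+1%:R) +
       complex.Re z * (- ln m.+1%:R * eta_re s (ln m.+1%:R)) +
       (- complex.Im z * (- ln m.+1%:R * eta_im s (ln m.+1%:R)) +
        r ^+ 2 * f q (ln m.+1%:R))).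
  by apply/funext => m; rewrite reE.
have -> : (fun m => eta_im (z + s) (ln m.+1%:R)) =
    (fun m => eta_im s (ln m.+1%:R) +
       complex.Re z * (- ln m.+1%:R * eta_im s (ln m.+1%:R)) +
       (complex.Im z * (- ln m.+1%:R * eta_re s (ln m.+1%:R)) +
        r ^+ 2 * g q (ln m.+1%:R))).
  by apply/funext => m; rewrite imE.
move: (f q) (g q) => fq gq; rewrite !euler_termD !euler_termZ.
move: (euler_term _ k) (euler_term _ k) (euler_term _ k) (euler_term _ k)
  (euler_term _ k) (euler_term _ k) => e1 e2 e3 e4 e5 e6.
case: z {reE imE zr Dq q qz} => z1 z2 /=.
by apply/eqP; rewrite eq_complex/=; apply/andP; split; apply/eqP; ring.
Qed.

End EtaTerm.

(** * Series dominated by a telescoping series *)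

Section Series.
Context {R : realType}.
Local Notation C := (R[i]^o).

Lemma telescope_le (K : R) m n : 0 <= K -> (m <= n)%N ->
  \sum_(m <= k < n) K / (k.+1 * k.+2)%:R <= K / m.+1%:R.
Proof.
move=> K0 mn.
have -> : \sum_(m <= k < n) K / (k.+1 * k.+2)%:R =
    \sum_(m <= k < n) (- (K / k.+2%:R) - - (K / k.+1%:R)).
  apply: eq_bigr => k _; rewrite opprK natrM.
  have k1 : k.+1%:R != 0 :> R by rewrite pnatr_eq0.
  have k2 : k.+2%:R != 0 :> R by rewrite pnatr_eq0.
  have k21 : k.+2%:R = k.+1%:R + 1 :> R by rewrite natr1.
  move: k1 k2; rewrite k21; move: (k.+1%:R) => x x0 x1; field.
  by rewrite x0 x1.
rewrite (telescope_sumr (fun k => - (K / k.+1%:R))) // opprK addrC gerDl.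
by rewrite oppr_le0 divr_ge0.
Qed.

Lemma cvg_series_le (a : R^nat) (K : R) : 0 <= K ->
  (forall k, `|a k| <= K / (k.+1 * k.+2)%:R) ->
  exists l, forall n, `|l - series a n| <= K / n.+1%:R.
Proof.
move=> K0 aK.
have ca : cvgn (series a).
  apply: normed_cvg; apply: nondecreasing_is_cvgn.
    by apply: nondecreasing_series => k _; rewrite normr_ge0.
  exists K => _ [n _ <-]; rewrite /series/=.
  apply: le_trans (ler_sum _ _) _; first by move=> k _; exact: aK.
  by apply: le_trans (telescope_le K0 (leq0n n)) _; rewrite divr1.
exists (limn (series a)) => n; apply/ler_addgt0Pr => e e0.
have /cvgrPdist_lt/(_ e e0)[N _ HN] := ca.
have := HN (maxn N n) (leq_maxl _ _) => /= lt.
rewrite -(subrK (series a (maxn N n)) (limn (series a))) -addrA addrC.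
apply: le_trans (ler_normD _ _) _; rewrite lerD ?(ltW lt)//.
rewrite sub_series_geq ?leq_maxr//.
apply: le_trans (ler_norm_sum _ _ _) _.
apply: le_trans (ler_sum _ _) _; first by move=> k _; exact: aK.
by apply: telescope_le => //; exact: leq_maxr.
Qed.

Lemma complex_gt0 (e : R[i]) : 0 < e -> exists2 r : R, 0 < r & e = r%:C.
Proof.
case: e => x y; rewrite ltcE/= => /andP[/eqP -> x0]; exists x => //.
Qed.

Lemma lt_div_nat (K e : R) : 0 <= K -> 0 < e ->
  exists N, forall n, (N <= n)%N -> K / n.+1%:R < e.
Proof.
move=> K0 e0; exists (Num.bound (K / e)) => n nN.
rewrite ltr_pdivrMr ?ltr0n// mulrC -ltr_pdivrMr//.
apply: lt_trans (archi_boundP (divr_ge0 K0 (ltW e0))) _.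
by rewrite ltr_nat ltnS.
Qed.

Lemma Re_sub (x y : R[i]) : complex.Re (x - y) = complex.Re x - complex.Re y.
Proof. by case: x y => a b [c d]. Qed.

Lemma Im_sub (x y : R[i]) : complex.Im (x - y) = complex.Im x - complex.Im y.
Proof. by case: x y => a b [c d]. Qed.

Lemma Re_series (a : C^nat) n :
  complex.Re (series a n) = series (fun k => complex.Re (a k)) n.
Proof.
rewrite /series/= (big_morph (@complex.Re R) (id1 := 0) (op1 := +%R))//.
by case=> ? ? [].
Qed.

Lemma Im_series (a : C^nat) n :
  complex.Im (series a n) = series (fun k => complex.Im (a k)) n.
Proof.
rewrite /series/= (big_morph (@complex.Im R) (id1 := 0) (op1 := +%R))//.
by case=> ? ? [].
Qed.

Lemma cseries_le (a : C^nat) (K : R) : 0 <= K ->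
  (forall k, `|a k| <= (K / (k.+1 * k.+2)%:R)%:C) ->
  series a @ \oo --> limn (series a) /\
  forall n, `|limn (series a) - series a n| <= (2 * K / n.+1%:R)%:C.
Proof.
move=> K0 aK.
have [x Hx] := @cvg_series_le (fun k => complex.Re (a k)) K K0
  (fun k => ltac:(rewrite -lecR; exact: le_trans (normc_ge_Re _) (aK k))).
have [y Hy] := @cvg_series_le (fun k => complex.Im (a k)) K K0
  (fun k => ltac:(rewrite -lecR; exact: le_trans (norm_complex_ge_Im _) (aK k))).
have Hl n : `|(x +i* y : C) - series a n| <= (2 * K / n.+1%:R)%:C.
  have -> : (x +i* y : C) - series a n =
      (x - complex.Re (series a n)) +i* (y - complex.Im (series a n)).
    by case: (series a n).
  apply: le_trans (norm_complex_le _ _) _.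
  by rewrite lecR [2 * K]mulr_natl mulr2n mulrDl lerD// ?Re_series ?Im_series.
have cl : series a @ \oo --> (x +i* y : C).
  apply/cvgrPdist_lt => _ /complex_gt0[e e0 ->].
  have [N HN] := lt_div_nat (mulr_ge0 (ler0n R 2) K0) e0.
  exists N => // n /= Nn; apply: le_lt_trans (Hl n) _.
  by rewrite ltcR HN.
have -> : limn (series a) = (x +i* y : C).
  by apply: cvg_lim cl; exact: norm_hausdorff.
by split.
Qed.

Lemma cvg_normed_cseries (a : C^nat) (K : R) : 0 <= K ->
  (forall k, `|a k| <= (K / (k.+1 * k.+2)%:R)%:C) ->
  cvgn [normed series a].
Proof.
move=> K0 aK.
have [] := @cseries_le (fun k => `|a k| : C) K K0.
  by move=> k; rewrite normr_id aK.
by move=> cl _; have := cvgP _ cl.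
Qed.

(** [Re] and [Im] are 1-Lipschitz, so they map a compact set to a compact, hence
    bounded, set of reals. *)
Lemma compact_re_im_bounded (A : set C) : compact A ->
  exists M : nat, forall s, A s ->
    `|complex.Re s| <= M%:R /\ `|complex.Im s| <= M%:R.
Proof.
move=> cA.
have bnd (f : C -> R) : (forall x y, f (x - y) = f x - f y) ->
    (forall x, `|f x|%:C <= `|x|) ->
    exists M, forall s, A s -> `|f s| <= M.
  move=> fB f_le.
  have cf : continuous f.
    move=> x; apply/(@cvgrPdist_lt _ R^o _ (nbhs (x : C)) (nbhs_filter (x : C))).
    move=> e e0.
    apply/nbhs_ballP; exists e%:C => /=; first by rewrite ltcR.
    move=> y; rewrite -ball_normE/= => xy; rewrite -ltcR -fB; exact: le_lt_trans xy.
  have := compact_bounded (continuous_compact (continuous_subspaceT cf) cA).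
  move=> [M [_ HM]]; exists (M + 1) => s As.
  by apply: (HM (M + 1)); [rewrite ltrDl|exists s].
have [M HM] := bnd _ Re_sub (@normc_ge_Re R).
have [L HL] := bnd _ Im_sub norm_complex_ge_Im.
exists (Num.bound (`|M| + `|L|)) => s As.
have b := ltW (archi_boundP (addr_ge0 (normr_ge0 M) (normr_ge0 L))).
split; apply: le_trans b.
  by apply: le_trans (HM s As) (le_trans (ler_norm _) _); rewrite lerDl.
by apply: le_trans (HL s As) (le_trans (ler_norm _) _); rewrite lerDr.
Qed.

End Series.

(** * Convergence and holomorphy *)

Section Main.
Context {R : realType} (kappa nu : R) (nu_gt0 : 0 < nu).
Local Notation C := (R[i]^o).

Lemma eta_cvg (M : nat) : exists2 K, 0 <= K & forall s : C,
  `|complex.Re s| <= M%:R -> `|complex.Im s| <= M%:R ->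
  [/\ cvgn [normed series (eta_term kappa nu ^~ s)],
      series (eta_term kappa nu ^~ s) @ \oo --> eta kappa nu s &
      forall n, `|eta kappa nu s - series (eta_term kappa nu ^~ s) n| <=
        (2 * K / n.+1%:R)%:C].
Proof.
have [K K0 HK] := eta_term_le kappa nu_gt0 M.
exists K => // s sr si.
have [c l] := cseries_le K0 (fun k => HK s k sr si).
split.
- exact: cvg_normed_cseries K0 (fun k => HK s k sr si).
- exact: c.
- exact: l.
Qed.

Lemma re_im_bounded (s : C) :
  exists M : nat, `|complex.Re s| <= M%:R /\ `|complex.Im s| <= M%:R.
Proof.
have [M HM] := compact_re_im_bounded (@compact_set1 _ s).
by exists M; exact: HM.
Qed.

(** The Taylor bound on the terms sums to
    [|eta (z + s) - eta s - z d| <= 2 K |z|^2], where [d] is the sum of the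
    derivatives of the terms. *)
Lemma entire_eta : entire (eta kappa nu).
Proof.
move=> s.
have cv (z : C) : series (eta_term kappa nu ^~ z) @ \oo --> eta kappa nu z.
  have [M [zr zi]] := re_im_bounded z.
  by have [K _ /(_ z zr zi)[]] := eta_cvg M.
have [L L0 HL] := eta_dterm_le kappa nu_gt0 s.
have [cd _] := cseries_le L0 HL.
set d := limn _ in cd.
have [K K0 HK] := eta_term_taylor_le kappa nu_gt0 s.
have taylor (z : C) (r : R) : `|z| = r%:C -> 0 < r -> r <= 1 ->
    `|eta kappa nu (z + s) - eta kappa nu s - z * d| <= (2 * (K * r ^+ 2))%:C.
  move=> zr r0 r1.
  have Kr : 0 <= K * r ^+ 2 by rewrite mulr_ge0// sqr_ge0.
  have [ct lt] := cseries_le Kr (fun k => HK k z r zr r0 r1).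
  (* The partial sum of index 0 is empty, so this bounds the whole sum. *)
  have := lt 0%N; rewrite {2}/series/= big_geq// subr0 divr1.
  suff -> : limn (series (fun k => eta_term kappa nu k (z + s) -
      eta_term kappa nu k s - z * eta_dterm kappa nu k s)) =
      eta kappa nu (z + s) - eta kappa nu s - z * d by [].
  apply: cvg_lim; first exact: norm_hausdorff.
  have -> : series (fun k => eta_term kappa nu k (z + s) -
      eta_term kappa nu k s - z * eta_dterm kappa nu k s) =
    (fun n => series (eta_term kappa nu ^~ (z + s)) n -
      series (eta_term kappa nu ^~ s) n - z * series (eta_dterm kappa nu ^~ s) n).
    by apply/funext => n; rewrite /series/= !sumrB mulr_sumr.
  apply: cvgB; first exact: cvgB (cv _) (cv _).
  exact: cvgMr cd.
apply/cvg_ex; exists d; apply/cvgrPdist_lt => _ /complex_gt0[e e0 ->].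
pose r := Num.min 1 (e / (2 * K + 1)).
have K1 : 0 < 2 * K + 1 by rewrite ltr_wpDl// mulr_ge0.
have r0 : 0 < r by rewrite lt_min ltr01 divr_gt0.
have r0C : 0 < r%:C :> R[i] by rewrite ltcR.
apply/nbhs_ballP; exists r%:C => //= z; rewrite -ball_normE/= sub0r normrN => zr z0.
have zE : `|z| = (Normc.normc z)%:C by [].
have n0 : 0 < Normc.normc z by rewrite -ltcR -zE normr_gt0.
have nr : Normc.normc z < r by rewrite -ltcR -zE.
have n1 : Normc.normc z <= 1 by apply: le_trans (ltW nr) _; rewrite ge_min lexx.
have := taylor z _ zE n0 n1.
rewrite -[z%:A]/(z * 1) mulr1.
rewrite -[_ *: _]/(_ * _).
have -> : d - z^-1 * (eta kappa nu (z + s) - eta kappa nu s) =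
   - (z^-1 * (eta kappa nu (z + s) - eta kappa nu s - z * d)).
  by rewrite [in RHS]mulrBr [z^-1 * (z * d)]mulrA mulVf// mul1r opprB.
move=> H; rewrite normrN normrM normfV mulrC.
rewrite ltr_pdivrMr ?normr_gt0//; apply: le_lt_trans H _.
rewrite zE -rmorphM/= ltcR expr2 mulrA mulrA ltr_pM2r//.
have : Normc.normc z < e / (2 * K + 1).
  by apply: lt_le_trans nr _; rewrite ge_min lexx orbT.
rewrite ltr_pdivlMr// => H; apply: le_lt_trans H.
rewrite [leRHS]mulrC ler_wpM2r ?(ltW n0)//.
by rewrite lerDl.
Qed.

End Main.

Theorem theorem2p1 (R : realType) (kappa nu : R)
    (kappa_gt0 : 0 < kappa) (nu_gt0 : 0 < nu) :
  [/\ forall s : R[i]^o, cvgn [normed series (eta_term kappa nu ^~ s)],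
      {family compact, (fun (n : nat) (s : R[i]^o) =>
          series (eta_term kappa nu ^~ s) n) @ \oo --> eta kappa nu}
    & entire (eta kappa nu)].
Proof.
split; last exact: entire_eta.
  move=> s; have [M [sr si]] := re_im_bounded s.
  by have [K _ /(_ s sr si)[]] := eta_cvg kappa nu_gt0 M.
apply/fam_cvgP => A cA.
have [M HM] := compact_re_im_bounded cA.
have [K K0 HK] := eta_cvg kappa nu_gt0 M.
move=> U /uniform_nbhs[E [entE EU]].
move: entE; rewrite -entourage_ballE => -[_ /complex_gt0[e e0 ->] eE].
have [N HN] := lt_div_nat (mulr_ge0 (ler0n R 2) K0) e0.
exists N => // n /= Nn; apply: EU => s As; apply: eE.
have [sr si] := HM s As; have [_ _ /(_ n) le] := HK s sr si.
rewrite /= -ball_normE/=; apply: le_lt_trans le _.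
by rewrite ltcR HN.
Qed.
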